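(* Let $\mathbf{k}$ be an algebraically closed field of characteristic $0$, let $T$ be a tree on the vertex set $\{1,\dots,n\}$ with $n\ge 4$, let $S=\mathbf{k}[x_1,\dots,x_n]$, and let $W_T$ be the Koszul module of $T$. Let $\mathcal{D}_T$ be the set of vertices of $T$ of degree at least $2$. Then the ideal $\operatorname{Fitt}_0(W_T)\subseteq S$ has a primary decomposition $$\operatorname{Fitt}_0(W_T)=\bigcap_{i\in\mathcal{D}_T}(x_i)^{\deg_T(i)-1}\ \cap\ J_T,$$ where $J_T$ is a non-radical monomial ideal whose radical equals $\mathfrak{m}=(x_1,\dots,x_n)$.
   Context: Let $V$ be an $n$-dimensional $\mathbf{k}$-vector space with basis $\{e_1,\dots,e_n\}$ and let $S=\operatorname{Sym}(V)=\mathbf{k}[x_1,\dots,x_n]$, where $x_i$ corresponds to $e_i$. For a linear subspace $K\subseteq\bigwedge^2V$, the Koszul module is the graded $S$-module $W(V,K)=\operatorname{coker}\left(\bigwedge^3V\otimes S(-1)\xrightarrow{\ \pi\circ\delta_3\ }(\bigwedge^2V/K)\otimes S\right)$, where $\pi:\bigwedge^2V\otimes S\to(\bigwedge^2V/K)\otimes S$ is the canonical projection and $\delta_3$ is the Koszul differential $a\wedge b\wedge c\otimes f\mapsto a\wedge b\otimes cf-a\wedge c\otimes bf+b\wedge c\otimes af$. For a simple graph $\Gamma$ on $\{1,\dots,n\}$ with edge set $\mathsf{E}$, let $K_\Gamma\subseteq\bigwedge^2V$ be the span of all $e_i\wedge e_j$ with $(i,j)\in\mathsf{E}$, and put $W_\Gamma=W(V,K_\Gamma)$;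 this applies in particular to $\Gamma=T$. $\operatorname{Fitt}_0$ denotes the $0$-th Fitting ideal, i.e. the ideal generated by the maximal minors of the matrix of the $S$-linear map $\pi\circ\delta_3:\bigwedge^3V\otimes S(-1)\to(\bigwedge^2V/K)\otimes S$, of size $\dim(\bigwedge^2V/K)$. $\deg_T(i)$ is the degree of the vertex $i$ in $T$. A tree on $n$ vertices is a connected simple graph with exactly $n-1$ edges. *)

(* Defs.v *)
From HB Require Import structures.
From mathcomp Require Import all_boot all_order all_algebra.
From mathcomp Require Import mpoly.
From mathcomp Require Import classical_sets.

Set Implicit Arguments.
Unset Strict Implicit.
Unset Printing Implicit Defensive.

Import GRing.Theory.
Local Open Scope ring_scope.
Local Open Scope classical_set_scope.

Section Ideals.
Variable R : comNzRingType.
Implicit Types (I J Q A : set R) (f g : R).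

Definition is_ideal I : Prop :=
  [/\ I 0, forall f g, I f -> I g -> I (f + g) & forall f g, I g -> I (f * g)].

Definition ideal_gen A : set R := smallest is_ideal A.

Definition ideal_mul I J : set R :=
  ideal_gen [set h | exists f g, [/\ I f, J g & h = f * g]].

Definition ideal_exp I (m : nat) : set R := iter m (ideal_mul I) setT.

Definition radical I : set R := [set f | exists m : nat, I (f ^+ m)].

Definition primary_ideal Q : Prop :=
  [/\ is_ideal Q, Q <> setT &
      forall f g, Q (f * g) -> Q f \/ exists m : nat, Q (g ^+ m)].

(* The [0]-th Fitting ideal of the cokernel of [u |-> u *m M] from [R^m] to
   [R^r].  The [r] distinct rows picked by [s] may come in any order, which
   changes a minor only by a sign. *)
Definition Fitt0 (m r : nat) (M : 'M[R]_(m, r)) : set R :=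
  ideal_gen [set h | exists2 s : 'I_r -> 'I_m, injective s
                                             & h = \det (rowsub s M)].

End Ideals.

Section MonomialIdeals.
Variables (k : fieldType) (n : nat).

Definition monomial_ideal (J : set {mpoly k[n]}) : Prop :=
  exists A : set 'X_{1..n},
    J = ideal_gen [set h | exists2 m : 'X_{1..n}, A m & h = 'X_[m]].

Definition var_ideal (i : 'I_n) : set {mpoly k[n]} := ideal_gen [set 'X_i].

Definition irrelevant_ideal : set {mpoly k[n]} :=
  ideal_gen [set h | exists i : 'I_n, h = 'X_i].

End MonomialIdeals.

(* [V = 'rV[k]_n] with [e_i = delta_mx 0 i].  The second and third exterior
   powers are given by coordinates in the bases [e_i /\ e_j], [i < j], and
   [e_a /\ e_b /\ e_c], [a < b < c]; enumerating the index sets makes them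
   spaces of row vectors. *)
Definition pairs (n : nat) : {set 'I_n * 'I_n} :=
  [set p : 'I_n * 'I_n | (p.1 < p.2)%N]%SET.

Definition triples (n : nat) : {set 'I_n * 'I_n * 'I_n} :=
  [set t : 'I_n * 'I_n * 'I_n | (t.1.1 < t.1.2 < t.2)%N]%SET.

Definition wedge2 (R : comNzRingType) (n : nat) (u v : 'rV[R]_n) :
    'rV[R]_#|pairs n| :=
  \row_p (let: (i, j) := enum_val p in u 0 i * v 0 j - u 0 j * v 0 i).

Section Koszul.
Variables (k : fieldType) (n : nat).
Notation S := {mpoly k[n]}.

(* Matrices act on row vectors from the right, so row [t] is the image of the
   basis element [e_a /\ e_b /\ e_c], where [t] enumerates [(a, b, c)]. *)
Definition koszul_delta3 : 'M[S]_(#|triples n|, #|pairs n|) :=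
  \matrix_t (let: (a, b, c) := enum_val t in
    let e i : 'rV[S]_n := delta_mx 0 i in
      'X_c *: wedge2 (e a) (e b) - 'X_b *: wedge2 (e a) (e c)
        + 'X_a *: wedge2 (e b) (e c)).

(* Let [K] be the row space of a matrix.  Since [u *m cokermx K = 0] iff [u] is
   in [K], and [cokermx K = col_base (cokermx K) *m row_base (cokermx K)] with
   a row-free right factor, [u |-> u *m proj_mod K] has kernel [K]; it is onto
   by rank, hence it is the projection onto the quotient by [K], written in a
   basis of that quotient. *)
Definition proj_mod (m N : nat) (K : 'M[k]_(m, N)) :
    'M[k]_(N, \rank (cokermx K)) := col_base (cokermx K).

(* The matrix of [pi \o delta_3], whose cokernel is [W(V, K)]. *)
Definition koszul_module_mx (m : nat) (K : 'M[k]_(m, #|pairs n|)) :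
    'M[S]_(#|triples n|, \rank (cokermx K)) :=
  koszul_delta3 *m map_mx (@mpolyC n k) (proj_mod K).

Definition graph_subspace (E : rel 'I_n) : 'M[k]_#|pairs n| :=
  (\sum_(p : 'I_n * 'I_n | E p.1 p.2)
      <<wedge2 (delta_mx 0 p.1 : 'rV[k]_n) (delta_mx 0 p.2)>>)%MS.

End Koszul.

(* [E] is the adjacency relation of a simple graph on ['I_n]. *)
Definition simple_graph (n : nat) (E : rel 'I_n) : Prop :=
  ssrbool.symmetric E /\ irreflexive E.

Definition is_tree (n : nat) (E : rel 'I_n) : Prop :=
  [/\ simple_graph E, forall i j : 'I_n, connect E i j &
      #|[pred p : 'I_n * 'I_n | (p.1 < p.2)%N && E p.1 p.2]| = n.-1].

Definition degree (n : nat) (E : rel 'I_n) (i : 'I_n) : nat :=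
  #|[pred j | E i j]|.

(* Main.v *)
(* At x = (1, ..., 1) the matrix delta_3 becomes the simplicial boundary map of
   the full simplex, and delta_3 itself is obtained from it by rescaling rows and
   columns by monomials.  Hence a maximal minor with row set s (a set of
   triangles) is a scalar times the monomial whose exponent at x_i is
   #{t in s : i in t} - (n - 1 - deg i).
   - If the scalar is nonzero, the chosen triangles avoiding i have independent
     boundaries among 1-cycles on n - 1 vertices, so there are at most
     C(n-2, 2) of them; at least n - 2 triangles contain i, and the exponent is
     at least deg i - 1.
   - The triangles through i form a cone over the tree; they give a nonzero
     minor, whose exponents at j <> i are exactly deg j - 1.
   So Fitt_0 is a monomial ideal contained in the principal ideal of
   P = prod_i x_i^(deg i - 1) and containing x_i^M P for every i and M large.
   Then J = Fitt_0 + m^N works for N large; it is not radical because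
   deg P = n - 2 >= 2 forces J to lie in m^2. *)

Require Import Defs.
From HB Require Import structures.
From mathcomp Require Import all_boot all_order all_algebra.
From mathcomp Require Import mpoly.
From mathcomp Require Import boolp classical_sets.
From mathcomp Require Import zify ring.

Set Implicit Arguments.
Unset Strict Implicit.
Unset Printing Implicit Defensive.

Import GRing.Theory.
Local Open Scope ring_scope.
Local Open Scope classical_set_scope.

(** * Ideals and supports of polynomials *)

Lemma ideal_gen_is_ideal (R : comNzRingType) (A : set R) :
  is_ideal (ideal_gen A).
Proof.
split.
- by move=> I [[I0 _ _] _].
- by move=> f g If Ig I HI; case: (HI) => [[_ ID _] _]; apply: ID; [apply: If|apply: Ig].
- by move=> f g Ig I HI; case: (HI) => [[_ _ IM] _]; apply: IM; apply: Ig.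
Qed.

Lemma sub_ideal_gen (R : comNzRingType) (A : set R) : A `<=` ideal_gen A.
Proof. by move=> a Aa I [_]; apply. Qed.

Lemma ideal_gen_min (R : comNzRingType) (A I : set R) :
  is_ideal I -> A `<=` I -> ideal_gen A `<=` I.
Proof. by move=> idI AI f; apply. Qed.

Lemma ideal_sum (R : comNzRingType) (I : set R) (T : eqType) (s : seq T) (F : T -> R) :
  is_ideal I -> (forall t, t \in s -> I (F t)) -> I (\sum_(t <- s) F t).
Proof.
case=> I0 ID _ IF; rewrite big_seq; elim/big_rec: _ => //= t f ts If.
by apply: ID => //; apply: IF.
Qed.

Section MonomialSupport.
Variables (k : fieldType) (n : nat).
Implicit Types (p q f g : {mpoly k[n]}) (U : set 'X_{1..n}).

(** For an up-closed [U] this is the monomial ideal with exponent set [U]. Encoding ideals through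
    supports turns equalities of monomial ideals into comparisons of exponent sets. *)
Definition msupp_in U : set {mpoly k[n]} :=
  [set p | forall m, m \in msupp p -> U m].

Definition up_closed U : Prop := forall m m', U m -> (m <= m')%MM -> U m'.

Definition up_closure U : set 'X_{1..n} := [set m | exists2 a, U a & (a <= m)%MM].

Lemma up_closureP U : up_closed (up_closure U).
Proof. by move=> m m' [a Ua am] mm'; exists a => //; apply: lepm_trans am mm'. Qed.

Lemma msupp_inM (U V W : set 'X_{1..n}) p q :
  (forall a b, U a -> V b -> W (a + b)%MM) ->
  msupp_in U p -> msupp_in V q -> msupp_in W (p * q).
Proof.
move=> UVW Up Vq m /msuppM_le /allpairsP [[a b] /= [ap bq ->]].
by apply: UVW; [apply: Up|apply: Vq].
Qed.

Lemma msupp_in_ideal U : up_closed U -> is_ideal (msupp_in U).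
Proof.
move=> upU; split=> [m|f g Uf Ug m|f g Ug].
- by rewrite msupp0.
- by move/msuppD_le; rewrite mem_cat => /orP[/Uf|/Ug].
- apply: (msupp_inM (U := setT) (V := U)) => // a b _ Ub.
  exact: upU Ub (lem_addl _ _).
Qed.

Lemma ideal_of_msupp (I : set {mpoly k[n]}) p :
  is_ideal I -> (forall m, m \in msupp p -> I 'X_[m]) -> I p.
Proof.
move=> idI Ip; rewrite (mpolyE p); apply: ideal_sum => // m mp.
by case: idI => _ _ IM; rewrite -mul_mpolyC; apply/IM/Ip.
Qed.

Lemma msupp_inX U m : msupp_in U 'X_[m] <-> U m.
Proof.
split; first by apply; rewrite msuppX mem_head.
by move=> Um m'; rewrite msuppX inE => /eqP->.
Qed.

(** A monomial above a generator's exponent is a multiple of that generator; conversely, sums and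
    multiples never leave the exponents above the generators. *)
Lemma monomial_ideal_gen U :
  ideal_gen [set h | exists2 m, U m & h = 'X_[m]] = msupp_in (up_closure U).
Proof.
apply/seteqP; split.
  apply: ideal_gen_min; first exact/msupp_in_ideal/up_closureP.
  by move=> _ [m Um ->]; apply/msupp_inX; exists m => //; apply: lepm_refl.
move=> p Up; apply: (ideal_of_msupp (ideal_gen_is_ideal _)) => m /Up [a Ua am].
rewrite -(submK am) mpolyXD; have [_ _ IM] := @ideal_gen_is_ideal {mpoly k[n]} [set h | exists2 m, U m & h = 'X_[m]].
by apply: IM; apply: sub_ideal_gen; exists a.
Qed.

Lemma var_idealE (i : 'I_n) :
  var_ideal (k := k) i = msupp_in [set m : 'X_{1..n} | (0 < m i)%N].
Proof.
have -> : [set m : 'X_{1..n} | (0 < m i)%N] = up_closure [set U_(i)%MM].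
  apply/seteqP; split=> m /=; last by case=> _ -> ; rewrite lep1mP lt0n.
  by rewrite lt0n -lep1mP => Um; exists U_(i)%MM.
rewrite -monomial_ideal_gen; congr ideal_gen.
by apply/seteqP; split=> [_ ->|_ [_ -> ->]] //=; exists U_(i)%MM.
Qed.

Lemma irrelevant_idealE : @irrelevant_ideal k n = [set p | p@_0%MM = 0].
Proof.
have -> : @irrelevant_ideal k n = msupp_in (up_closure [set m | exists i, m = U_(i)%MM]).
  rewrite -monomial_ideal_gen; congr ideal_gen.
  apply/seteqP; split=> [_ [i ->]|_ [_ [i ->] ->]]; last by exists i.
  by exists U_(i)%MM => //; exists i.
apply/seteqP; split=> p /= Hp.
  apply/eqP; rewrite mcoeff_eq0; apply/negP => /Hp [_ [i ->]].
  by rewrite lep1mP mnm0E.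
move=> m mp; have : m != 0%MM.
  by apply: contraTneq mp => ->; rewrite -mcoeff_eq0 Hp.
rewrite -mdeg_eq0 mdegE sum_nat_eq0 => /forallPn [i mi].
by exists U_(i)%MM; [exists i|rewrite lep1mP].
Qed.

Lemma var_ideal_exp (i : 'I_n) e :
  ideal_exp (var_ideal (k := k) i) e = msupp_in [set m : 'X_{1..n} | (e <= m i)%N].
Proof.
have up d : up_closed [set m : 'X_{1..n} | (d <= m i)%N].
  by move=> m m' /= dm /mnm_lepP /(_ i); apply: leq_trans.
elim: e => [|e IHe]; first by apply/seteqP; split.
rewrite /ideal_exp iterS -/(ideal_exp _ e) IHe var_idealE; apply/seteqP; split.
  apply: ideal_gen_min; first exact: msupp_in_ideal.
  move=> _ [f [g [Hf Hg ->]]]; move: Hf Hg; apply: msupp_inM => a b /=.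
  by rewrite mnmDE; lia.
move=> p Hp; apply: (ideal_of_msupp (ideal_gen_is_ideal _)) => m /Hp /= em.
have Um : (U_(i) <= m)%MM by rewrite lep1mP -lt0n; apply: leq_trans em.
apply: sub_ideal_gen; exists 'X_i, 'X_[m - U_(i)]; split.
- by apply/msupp_inX; rewrite /= mnm1E eqxx.
- by apply/msupp_inX; rewrite /= mnmBE mnm1E eqxx; lia.
- by rewrite -mpolyXD addmC submK.
Qed.

Lemma mcoeff_part p (P : pred 'X_{1..n}) m :
  (\sum_(a <- msupp p | P a) p@_a *: 'X_[a])@_m = if P m then p@_m else 0.
Proof.
rewrite raddf_sum /= (eq_bigr (fun a => if a == m then p@_m else 0)); last first.
  move=> a _; rewrite mcoeffZ mcoeffX; case: eqVneq => [->|_]; first by rewrite mulr1.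
  by rewrite mulr0.
have [mp|mp] := boolP (m \in msupp p).
  rewrite (big_rem m mp) /= eqxx big1_seq ?addr0 // => a /andP[_].
  by rewrite mem_rem_uniq ?msupp_uniq // inE => /andP[/negPf->].
rewrite (memN_msupp_eq0 mp) if_same big1 // => a _.
by case: ifP.
Qed.

Lemma msupp_part p (P : pred 'X_{1..n}) :
  exists p1 p2, [/\ p = p1 + p2,
    forall m, (m \in msupp p1) = P m && (m \in msupp p) &
    forall m, (m \in msupp p2) = ~~ P m && (m \in msupp p)].
Proof.
exists (\sum_(a <- msupp p | P a) p@_a *: 'X_[a]).
exists (\sum_(a <- msupp p | ~~ P a) p@_a *: 'X_[a]); split.
- by rewrite [LHS]mpolyE (bigID P).
- by move=> m; rewrite !mcoeff_msupp mcoeff_part /=; case: (P m); rewrite ?eqxx.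
- by move=> m; rewrite !mcoeff_msupp mcoeff_part /=; case: (P m); rewrite ?eqxx.
Qed.

(* The parts of [f] and [g] of least degree in [x_i] have a nonzero product,
   which no other terms of [f * g] can cancel. *)
Lemma var_ideal_exp_primary (i : 'I_n) e :
  (0 < e)%N -> primary_ideal (ideal_exp (var_ideal (k := k) i) e).
Proof.
move=> e0; rewrite var_ideal_exp.
have idQ d : is_ideal (msupp_in [set m : 'X_{1..n} | (d <= m i)%N]).
  by apply: msupp_in_ideal => m m' /= dm /mnm_lepP /(_ i); apply: leq_trans.
split=> //.
  move=> /seteqP [_ /(_ 1 I) /(_ 0%MM)].
  by rewrite msupp1 mem_head /= mnm0E => /(_ isT); lia.
have low d f : ~ msupp_in [set m : 'X_{1..n} | (d <= m i)%N] f ->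
  exists a f1 f2, [/\ (a < d)%N, f = f1 + f2, f1 != 0, msupp_in [set m | m i == a] f1
    & msupp_in [set m | (a < m i)%N] f2].
  move=> Hf; have ex : exists a, has (fun m : 'X_{1..n} => m i == a) (msupp f).
    have [|] := boolP (has xpredT (msupp f)).
      by case/hasP => m mf _; exists (m i); apply/hasP; exists m.
    by move=> /hasPn H; case: Hf => m /H.
  have [a /hasP[m mf /eqP ma] amin] := ex_minnP ex.
  have [f1 [f2 [ef Hf1 Hf2]]] := msupp_part f (fun m => m i == a).
  exists a, f1, f2; split=> //.
  - rewrite ltnNge; apply/negP => da; apply: Hf => m' m'f /=.
    by apply: leq_trans da (amin _ _); apply/hasP; exists m'.
  - by apply/negP => /eqP f10; have := Hf1 m; rewrite f10 msupp0 mf ma eqxx.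
  - by move=> m' /=; rewrite Hf1 => /andP[].
  - move=> m' /=; rewrite Hf2 => /andP[neq m'f]; rewrite ltn_neqAle eq_sym neq /=.
    by apply: amin; apply/hasP; exists m'.
move=> f g fg; have [|/low] := pselect (msupp_in [set m : 'X_{1..n} | (e <= m i)%N] f).
  by left.
move=> [a [f1 [f2 [ae ef f10 Hf1 Hf2]]]]; right; exists e.
have [|/low] := pselect (msupp_in [set m : 'X_{1..n} | (1 <= m i)%N] g).
  rewrite -var_idealE => Hg; rewrite -var_ideal_exp.
  elim: (e) => [//|d IHd]; rewrite /ideal_exp iterS exprS; apply: sub_ideal_gen.
  by exists g, (g ^+ d).
(* Here [b] is 0, so the lowest part of [f * g] has degree [a < e] in the variable, contradicting
   [fg]. *)
move=> [b [g1 [g2 [b1 eg g10 Hg1 Hg2]]]].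
have := mulf_neq0 f10 g10; rewrite -msupp_eq0.
case E: (msupp (f1 * g1)) => [//|m s] _.
have mfg : m \in msupp (f1 * g1) by rewrite E mem_head.
have mab : m i = (a + b)%N.
  have: msupp_in [set m | m i == (a + b)%N] (f1 * g1).
    apply: msupp_inM Hf1 Hg1 => u v /= /eqP <- /eqP <-.
    by rewrite mnmDE.
  by move/(_ _ mfg) => /= /eqP.
have : m \in msupp (f * g).
  rewrite mcoeff_msupp (_ : f * g = f1 * g1 + (f1 * g2 + f2 * g)); last first.
    by rewrite addrA -mulrDr -eg -mulrDl -ef.
  rewrite mcoeffD [X in _ + X]memN_msupp_eq0 ?addr0 -?mcoeff_msupp //.
  have up: up_closed [set m : 'X_{1..n} | (a + b < m i)%N].
    by move=> u v /= du /mnm_lepP /(_ i); apply: leq_trans.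
  apply/negP; have [_ ID _] := msupp_in_ideal up.
  suff: msupp_in [set m : 'X_{1..n} | (a + b < m i)%N] (f1 * g2 + f2 * g).
    by move=> H /H /=; rewrite mab ltnn.
  apply: ID; first by apply: msupp_inM Hf1 Hg2 => u v /= /eqP; rewrite mnmDE; lia.
  apply: (msupp_inM (V := setT)) Hf2 _ => // u v /=; rewrite mnmDE; lia.
by move=> /fg /=; rewrite mab; lia.
Qed.
End MonomialSupport.

(** * Splitting a monomial ideal into powers of variables and an irrelevant component *)

Section Decomposition.
Variables (k : fieldType) (n : nat).
Implicit Types (p q f g : {mpoly k[n]}) (U : set 'X_{1..n}).

Lemma msupp_exp_mdeg p e :
  p@_0%MM = 0 -> msupp_in [set m : 'X_{1..n} | (e <= mdeg m)%N] (p ^+ e).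
Proof.
move=> p0; elim: e => [//|e IHe]; rewrite exprS.
apply: (msupp_inM (U := [set m : 'X_{1..n} | (0 < mdeg m)%N])) IHe.
  by move=> a b /=; rewrite mdegD; lia.
move=> m mp /=; rewrite lt0n mdeg_eq0; apply: contraTneq mp => ->.
by rewrite -mcoeff_eq0 p0.
Qed.

(* If [g] lies outside the maximal ideal, then [g = c * (1 - u)] with [c] a
   nonzero constant and [u] nilpotent modulo [J], so [g] is a unit modulo [J]. *)
Lemma irrelevant_primary (J : set {mpoly k[n]}) e :
    is_ideal J -> (forall p, J p -> p@_0%MM = 0) ->
    (forall p, p@_0%MM = 0 -> J (p ^+ e)) ->
  primary_ideal J /\ radical J = @irrelevant_ideal k n.
Proof.
move=> idJ Jm mJ; split; last first.
  rewrite irrelevant_idealE; apply/seteqP; split=> [p [d /Jm]|p p0] /=; last first.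
    by exists e; apply: mJ.
  have := rmorphXn (mcoeff 0%MM : {mpoly k[n]} -> k) d p; rewrite /= => -> /eqP.
  by rewrite expf_eq0 => /andP[_ /eqP].
split=> // [JT|f g Jfg].
  have /Jm : J 1 by rewrite JT.
  by move/eqP; rewrite mcoeff1 eqxx oner_eq0.
have [g0|g0] := eqVneq g@_0%MM 0; first by right; exists e; apply: mJ.
left; set c := g@_0%MM in g0.
pose u := 1 - (c^-1)%:MP * g.
have Ju : J (u ^+ e).
  by apply: mJ; rewrite mcoeffB mcoeffCM mulVf // mcoeff1 eqxx subrr.
have [_ JD JM] := idJ.
(* Since [1 - u] is [g] divided by [c], the geometric sum turns the second term into
   [f * (1 - u ^+ e)]. *)
have -> : f = f * u ^+ e + ((c^-1)%:MP * \sum_(i < e) u ^+ i) * (f * g).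
  have -> : (c^-1)%:MP * (\sum_(i < e) u ^+ i) * (f * g) = f * (1 - u ^+ e).
    rewrite -opprB subrX1 -mulNr opprB /u; ring.
  by rewrite -mulrDr addrC subrK mulr1.
by apply: JD; apply: JM.
Qed.

(** Let P be the monomial with exponents [d]. A multiple of P of large degree has some exponent at
    least [d i + B], hence lies above the element of [A] supplied for that [i]. Adding all monomials
    of large degree to [A] therefore changes nothing after intersecting with the powers of
    variables. *)
Lemma monomial_decomposition (A : set 'X_{1..n}) (d : 'I_n -> nat) B :
    (forall a i, A a -> (d i <= a i)%N) ->
    (forall i, exists2 a, A a & forall j, (a j <= d j + (j == i) * B)%N) ->
    (2 <= \sum_i d i)%N ->
  exists J : set {mpoly k[n]},
    [/\ monomial_ideal J, radical J <> J, radical J = @irrelevant_ideal k n,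
        primary_ideal J &
        ideal_gen [set h | exists2 m, A m & h = 'X_[m]]
          = (\bigcap_(i in [set i | (0 < d i)%N]) ideal_exp (var_ideal (k := k) i) (d i)) `&` J].
Proof.
(* By pigeonhole, degree at least [N] forces an exponent at least [d i + B]. The summand 2 keeps the
   added monomials in degree at least 2. *)
move=> Ad AB d2; pose N := (\sum_i (d i + B) + 2)%N.
pose A' := [set m : 'X_{1..n} | A m \/ (N <= mdeg m)%N].
pose J : set {mpoly k[n]} := ideal_gen [set h | exists2 m, A' m & h = 'X_[m]].
have JE : J = msupp_in (up_closure A') by apply: monomial_ideal_gen.
(* Thus elements of [J] have no constant term, and no variable lies in [J], although every variable
   lies in its radical. *)
have A2 m : up_closure A' m -> (2 <= mdeg m)%N.
  case=> a Aa am; have: (2 <= mdeg a)%N.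
    case: Aa => [Aa|]; last by rewrite /N; lia.
    by rewrite mdegE; apply: leq_trans d2 _; apply: leq_sum => i _; apply: Ad.
  have: (mdeg a <= mdeg m)%N by rewrite -(submK am) mdegD leq_addl.
  lia.
have [] := @irrelevant_primary J N.
- by rewrite JE; apply/msupp_in_ideal/up_closureP.
- move=> p; rewrite JE => Jp; apply/eqP; rewrite mcoeff_eq0; apply/negP.
  by move=> /Jp /A2; rewrite mdeg0.
- move=> p /msupp_exp_mdeg Np; rewrite JE => m /Np /= Nm.
  by exists m; [right|apply: lepm_refl].
move=> primJ radJ; exists J; split=> //.
- by exists A'.
- have n0 : (0 < n)%N.
    by rewrite lt0n; apply: contraTneq d2 => n0; move: (d); rewrite n0 => ?; rewrite big_ord0.
  rewrite radJ irrelevant_idealE JE => E.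
  have: msupp_in (up_closure A') ('X_(Ordinal n0) : {mpoly k[n]}).
    by rewrite -E /= mcoeffX mnm1_eq0.
  by move/msupp_inX/A2; rewrite mdeg1.
rewrite monomial_ideal_gen JE; apply/seteqP; split=> [p Ap|p [Qp Jp] m mp].
  split=> [i _|m /Ap [a Aa am]]; last by exists a => //; left.
  rewrite var_ideal_exp => m /Ap [a Aa /mnm_lepP /(_ i)].
  by apply: leq_trans; apply: Ad.
have dm i : (d i <= m i)%N.
  case: (posnP (d i)) => [->//|di].
  by have := Qp i di; rewrite var_ideal_exp; apply.
have [a [Aa|Na] am] := Jp m mp; first by exists a.
have [i Bi] : exists i, (d i + B <= m i)%N.
  apply/existsP; apply: contraLR Na => /existsPn H; rewrite -ltnNge /N.
  apply: (@leq_ltn_trans (mdeg m)); first by rewrite -(submK am) mdegD leq_addl.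
  suff: (mdeg m <= \sum_i (d i + B))%N by lia.
  by rewrite mdegE; apply: leq_sum => i _; have := H i; lia.
have [b Ab Hb] := AB i; exists b => //; apply/mnm_lepP => j.
have := Hb j; case: eqVneq => [->|_]; have := dm j; lia.
Qed.
End Decomposition.

(** * Double counting of pairs and triangles through given vertices *)

Lemma card_enum_val (T : finType) (A : {pred T}) (P : pred T) :
  #|[pred q : 'I_#|A| | P (enum_val q)]| = #|[pred x in A | P x]|.
Proof.
rewrite -[LHS]sum1_card -[RHS]sum1_card -[LHS](big_enum_val_cond P (fun=> 1%N)).
by apply: eq_bigl => x; rewrite !inE.
Qed.

Section Counting.
Variable n : nat.
Implicit Types (i j a b : 'I_n) (E : rel 'I_n).

Definition pair_at (p : 'I_n * 'I_n) i : bool := (i == p.1) || (i == p.2).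

Definition triple_at (t : 'I_n * 'I_n * 'I_n) i : bool :=
  [|| i == t.1.1, i == t.1.2 | i == t.2].

(** Each neighbour of [i] lies either above or below [i] and yields exactly one increasing pair
    through [i]. *)
Lemma sum_pair_at E i : ssrbool.symmetric E -> irreflexive E ->
  (\sum_(p in pairs n | E p.1 p.2) pair_at p i = #|E i|)%N.
Proof.
move=> symE irrE.
pose e a b : nat := (a < b)%N && E a b.
transitivity (\sum_a \sum_b ((i == a) * e a b + (i == b) * e a b))%N.
  rewrite pair_big big_mkcond /=; apply: eq_bigr => -[a b] _.
  rewrite inE /pair_at /e /=; case: ltnP => /= ab; case: (E a b); rewrite /= ?muln0 //.
  by rewrite !muln1; do 2 (case: eqVneq => //= ?); subst; lia.
under eq_bigr do rewrite big_split -big_distrr /=.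
rewrite big_split /= [X in (_ + X)%N]exchange_big /=.
under [X in (_ + X)%N]eq_bigr do rewrite -big_distrr /=.
rewrite -big_split /= (bigD1 i) //= eqxx !mul1n [X in (_ + X)%N]big1 ?addn0; last first.
  by move=> a; rewrite eq_sym => /negPf->; rewrite !mul0n.
rewrite -big_split -sum1_card [RHS]big_mkcond /=; apply: eq_bigr => a _.
rewrite unfold_in /e (symE a i).
by case: ltngtP => [||/val_inj->]; rewrite ?irrE //; case: (E i _).
Qed.

(** The handshake lemma: every pair has exactly two ends. *)
Lemma card_pairs2 E : ssrbool.symmetric E -> irreflexive E ->
  (#|[pred p in pairs n | E p.1 p.2]| * 2 = \sum_i #|E i|)%N.
Proof.
move=> symE irrE; under eq_bigr do rewrite -(sum_pair_at _ symE irrE).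
rewrite exchange_big /= -sum_nat_const; apply: eq_big => [p|p]; first by rewrite !inE.
rewrite inE /pair_at => /andP[+ _]; rewrite inE => lt_p.
rewrite (bigD1 p.1) //= eqxx (bigD1 p.2) /=; last by rewrite -val_eqE /=; lia.
by rewrite eqxx orbT big1 // => i /andP[/negPf-> /negPf->].
Qed.

(** A triangle through [i] and [j] is determined by its third vertex, which [g] extracts. *)
Lemma card_triple_at2 i j : i != j ->
  (#|[pred t in triples n | triple_at t i && triple_at t j]| <= n - 2)%N.
Proof.
move=> ij; have c2: #|[set i; j]%SET| = 2%N by rewrite cards2 ij.
have -> : (n - 2 = #|(~: [set i; j])%SET|)%N by have := cardsC [set i; j]%SET; rewrite c2 card_ord; lia.
have eE (x y : 'I_n) : (x == y) = (x == y :> nat) by [].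
pose g (t : 'I_n * 'I_n * 'I_n) := if t.1.1 \notin [set i; j]%SET then t.1.1
  else if t.1.2 \notin [set i; j]%SET then t.1.2 else t.2.
have gP t : t \in [pred t in triples n | triple_at t i && triple_at t j] ->
    [/\ g t != i, g t != j & triple_at t (g t)].
  case: t => [[a b] c]; rewrite !inE /g /triple_at !inE /= !eE => H; move: ij; rewrite eE => ?.
  case: (boolP (_ || _)) => H1 /=; last by split; rewrite ?eE; lia.
  by case: (boolP (_ || _)) => H2 /=; split; rewrite ?eE; lia.
rewrite -(@card_in_imset _ _ g).
  apply/subset_leq_card/fintype.subsetP => _ /imsetP[t /gP[ti tj _] ->].
  by rewrite !inE negb_or ti tj.
move=> t t' tA t'A gt; have := gP _ tA; have := gP _ t'A; rewrite -gt.
move: (g t) => x; case: t t' tA t'A {gt} => [[a b] c] [[a' b'] c'].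
rewrite !inE /triple_at /= !eE => H H' [xi xj Hx] [_ _ Hx'].
suff: [/\ a = a' :> nat, b = b' :> nat & c = c' :> nat].
  by case=> /val_inj-> /val_inj-> /val_inj->.
by move: ij; rewrite eE; split; lia.
Qed.
End Counting.

(** * Minors of the Koszul differential *)

Section KoszulMinors.
Variables (k : fieldType) (n : nat).
Notation S := {mpoly k[n]}.

(* The values at [x_1 = ... = x_n = 1] of the entries of [delta_3], i.e. the
   simplicial boundary map from triangles to edges of the full simplex. *)
Definition simplex_boundary : 'M[k]_(#|triples n|, #|pairs n|) :=
  \matrix_(t, q) (let: (a, b, c) := enum_val t in
    ((a, b) == enum_val q)%:R - ((a, c) == enum_val q)%:R
      + ((b, c) == enum_val q)%:R).

Definition pair_mon (p : 'I_n * 'I_n) : 'X_{1..n} := (U_(p.1) + U_(p.2))%MM.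

Definition triple_mon (t : 'I_n * 'I_n * 'I_n) : 'X_{1..n} :=
  (U_(t.1.1) + U_(t.1.2) + U_(t.2))%MM.

Lemma pair_monE p i : p \in pairs n -> pair_mon p i = pair_at p i.
Proof.
case: p => a b; rewrite inE mnmDE !mnm1E /pair_at ![_ == i]eq_sym /= => lt_p.
by do 2 (case: eqVneq => //= ?); subst; lia.
Qed.

Lemma triple_monE t i : t \in triples n -> triple_mon t i = triple_at t i.
Proof.
case: t => [[a b] c]; rewrite inE !mnmDE !mnm1E /triple_at ![_ == i]eq_sym /= => lt_p.
by do 3 (case: eqVneq => //= ?); subst; lia.
Qed.

Lemma wedge2_delta (R : comNzRingType) (a b : 'I_n) q : (a < b)%N ->
  wedge2 (delta_mx 0 a : 'rV[R]_n) (delta_mx 0 b) 0 q = ((a, b) == enum_val q)%:R.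
Proof.
move=> ab; rewrite mxE; have := enum_valP q; case: (enum_val q) => i j.
rewrite inE !mxE !eqxx /= xpair_eqE ![_ == a]eq_sym ![_ == b]eq_sym => ij.
rewrite -!natrM !mulnb; case: (eqVneq a j) => [?|_] /=; last by rewrite subr0.
by case: (eqVneq b i) => [?|_] /=; subst; [lia|rewrite subr0].
Qed.

(** A nonzero entry is, up to sign, the variable of the vertex of the triangle missing from the
    pair; multiplying by the pair's monomial completes it to the triangle's monomial. *)
Lemma koszul_delta3_scaling t q :
  koszul_delta3 k n t q * 'X_[pair_mon (enum_val q)]
    = 'X_[triple_mon (enum_val t)] * (simplex_boundary t q)%:MP.
Proof.
rewrite !mxE; have := enum_valP t; case: (enum_val t) => [[a b] c].
rewrite inE /= => /andP[ab bc]; have ac := ltn_trans ab bc.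
set Xabc := 'X_[triple_mon _].
have linE (x y z : S) (A B C : 'rV[S]_#|pairs n|) :
  (x *: A - y *: B + z *: C) 0 q = x * A 0 q - y * B 0 q + z * C 0 q by rewrite !mxE.
rewrite linE.
have H (u v w : 'I_n) : Xabc = 'X_w * 'X_[pair_mon (u, v)] -> (u < v)%N ->
   'X_w * wedge2 (delta_mx 0 u : 'rV[S]_n) (delta_mx 0 v) 0 q * 'X_[pair_mon (enum_val q)]
   = Xabc * (((u, v) == enum_val q)%:R)%:MP.
  move=> eX uv; rewrite wedge2_delta //; case: eqVneq => [<-|_].
    by rewrite mulr1 mpolyC1 mulr1.
  by rewrite mulr0 mul0r mpolyC0 mulr0.
rewrite mpolyCD mpolyCB mulrDr mulrBr -(H a b c) -?(H a c b) -?(H b c a) //.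
  by rewrite !mulrDl mulNr.
all: rewrite /Xabc -mpolyXD; congr 'X_[_]; apply/mnmP => i; rewrite !mnmDE /=; lia.
Qed.

Variables (r : nat) (f : 'I_r -> 'I_#|pairs n|).
Implicit Type s : 'I_r -> 'I_#|triples n|.

Lemma minor_scaling s :
  \det (mxsub s f (koszul_delta3 k n)) * 'X_[\sum_j pair_mon (enum_val (f j))]
   = 'X_[\sum_j triple_mon (enum_val (s j))] * (\det (mxsub s f simplex_boundary))%:MP.
Proof.
have -> : 'X_[\sum_j pair_mon (enum_val (f j))] =
   \det (diag_mx (\row_j 'X_[pair_mon (enum_val (f j))])) :> S.
  by rewrite det_diag (big_morph _ (@mpolyXD _ _) (@mpolyX0 _ _)); apply: eq_bigr => j _; rewrite mxE.
have -> : 'X_[\sum_j triple_mon (enum_val (s j))] =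
   \det (diag_mx (\row_j 'X_[triple_mon (enum_val (s j))])) :> S.
  by rewrite det_diag (big_morph _ (@mpolyXD _ _) (@mpolyX0 _ _)); apply: eq_bigr => j _; rewrite mxE.
rewrite -det_map_mx -!det_mulmx; congr (\det _); apply/matrixP => i j.
have rowE (F : 'I_r -> S) l : (\row_l F l) 0 l = F l by rewrite mxE.
have subE (R : Type) (A : 'M[R]_(_, _)) : mxsub s f A i j = A (s i) (f j) by rewrite mxE.
have mapE (A : 'M[k]_r) : map_mx (@mpolyC n k) A i j = (A i j)%:MP by rewrite mxE.
rewrite mul_mx_diag mul_diag_mx [LHS]mxE [RHS]mxE !rowE mapE !subE.
exact: koszul_delta3_scaling.
Qed.

Lemma simplex_boundary0 t q i : ~~ triple_at (enum_val t) i ->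
  pair_at (enum_val q) i -> simplex_boundary t q = 0.
Proof.
rewrite mxE; case: (enum_val t) => [[a b] c]; rewrite /triple_at /= !negb_or.
case/and3P => ia ib ic qi; suff H u v : i != u -> i != v -> (u, v) == enum_val q = false.
  by rewrite !H // subrr addr0.
move=> iu iv; apply/eqP => E; move: qi; rewrite -E /pair_at /=.
by rewrite (negPf iu) (negPf iv).
Qed.

Definition coboundary (h : 'I_n -> k) : 'cV[k]_#|pairs n| :=
  \col_q (h (enum_val q).2 - h (enum_val q).1).

Lemma coboundaryE h q :
  coboundary h q 0 = h (enum_val q).2 - h (enum_val q).1.
Proof. by rewrite mxE. Qed.

(* Value of a cochain on a pair, by summation so that no index of the pair is
   needed; it is [0] on pairs that are not increasing. *)
Definition cochain_at (v : 'cV[k]_#|pairs n|) (p : 'I_n * 'I_n) : k :=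
  \sum_q (p == enum_val q)%:R * v q 0.

Lemma cochain_at_enum v q : cochain_at v (enum_val q) = v q 0.
Proof.
rewrite /cochain_at (bigD1 q) //= eqxx mul1r big1 ?addr0 // => q' /negPf q'q.
by rewrite (inj_eq enum_val_inj) eq_sym q'q mul0r.
Qed.

Lemma simplex_boundary_mul v t a b c : enum_val t = (a, b, c) ->
  (simplex_boundary *m v) t 0
    = cochain_at v (a, b) - cochain_at v (a, c) + cochain_at v (b, c).
Proof.
move=> et; rewrite mxE -sumrB -big_split /=; apply: eq_bigr => q _.
by rewrite mxE et !mulrDl mulNr.
Qed.

Lemma cochain_at_coboundary h (a b : 'I_n) : (a < b)%N ->
  cochain_at (coboundary h) (a, b) = h b - h a.
Proof.
move=> ab; have abP : (a, b) \in pairs n by rewrite inE.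
by rewrite -[(a, b)](enum_rankK_in abP abP) cochain_at_enum mxE enum_rankK_in.
Qed.

Lemma simplex_boundary_coboundary h : simplex_boundary *m coboundary h = 0.
Proof.
apply/colP => t; have := enum_valP t; case et: (enum_val t) => [[a b] c].
rewrite inE /= => /andP[ab bc]; rewrite (simplex_boundary_mul _ et).
rewrite !cochain_at_coboundary //; last exact: ltn_trans bc.
by rewrite mxE; ring.
Qed.

End KoszulMinors.

(** * Independent rows and nonzero minors of the simplicial boundary map *)

Section SimplexBoundaryRank.
Variables (k : fieldType) (n r : nat) (f : 'I_r -> 'I_#|pairs n|).
Implicit Type s : 'I_r -> 'I_#|triples n|.

(* A combination [y] of rows avoiding [i] vanishes on the pairs meeting [i] and
   on all coboundaries.  If it also vanishes on the pairs avoiding [i] and [j],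
   then testing it on the coboundary of the indicator of [c] kills its entry at
   [{j, c}]; so these rows stay independent on the pairs avoiding [i] and [j]. *)
Lemma card_rows_avoiding s i j : \det (mxsub s f (simplex_boundary k n)) != 0 ->
  (#|[pred t | ~~ triple_at (enum_val (s t)) i]|
    <= #|[pred q : 'I_#|pairs n| | ~~ pair_at (enum_val q) i && ~~ pair_at (enum_val q) j]|)%N.
Proof.
set P := [pred t | _]; set Q := [pred q | _] => det_neq0.
have A_unit : mxsub s f (simplex_boundary k n) \in unitmx by rewrite unitmxE unitfE.
pose B := rowsub (fun z : 'I_#|P| => s (enum_val z)) (simplex_boundary k n).
suff: row_free (colsub (fun z : 'I_#|Q| => enum_val z) B) by move/eqP <-; apply: rank_leq_col.
apply: inj_row_free => u; rewrite mulmx_colsub; set y := u *m B => yQ.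
have y_i q : pair_at (enum_val q) i -> y 0 q = 0.
  move=> qi; rewrite mxE big1 // => z _; rewrite mxE (simplex_boundary0 _ (i := i)) ?mulr0 //.
  exact: (enum_valP z).
have y_Q q : ~~ pair_at (enum_val q) j -> y 0 q = 0.
  move=> qj; have [/y_i//|qi] := boolP (pair_at (enum_val q) i).
  have qQ : q \in Q by rewrite inE qi qj.
  by move/rowP/(_ (enum_rank_in qQ q)): yQ; rewrite !mxE enum_rankK_in.
have y0 : y = 0.
  apply/rowP => q; rewrite [RHS]mxE; have [qj|/y_Q//] := boolP (pair_at (enum_val q) j).
  (* [c] is the other end of [q]. Among the pairs through [j], only [q] meets [c], so testing
     against the indicator of [c] isolates the entry at [q]. *)
  pose c := if j == (enum_val q).1 then (enum_val q).2 else (enum_val q).1.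
  have : y *m coboundary (fun i => (i == c)%:R) = 0.
    by rewrite -mulmxA mul_rowsub_mx simplex_boundary_coboundary mxsub_const mulmx0.
  move/matrixP/(_ 0 0); rewrite [RHS]mxE [LHS]mxE (bigD1 q) //= big1 => [|q' q'q].
    rewrite addr0 coboundaryE /c; have := enum_valP q; rewrite inE.
    move: qj; rewrite /pair_at; case: (enum_val q) => a b /= + ab.
    have /negPf ba : b != a by rewrite -val_eqE /= gtn_eqF.
    case: (eqVneq j a) => [_ _|_ /= _]; rewrite eqxx ?ba ?[a == b]eq_sym ?ba.
      by rewrite subr0 mulr1.
    by rewrite sub0r mulrN1 => /eqP; rewrite oppr_eq0 => /eqP.
  have [q'j|/y_Q->] := boolP (pair_at (enum_val q') j); last by rewrite mul0r.
  suff [c1 c2] : (enum_val q').1 != c /\ (enum_val q').2 != c.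
    by rewrite coboundaryE (negPf c1) (negPf c2) subrr mulr0.
  have := enum_valP q; have := enum_valP q'.
  have: enum_val q' != enum_val q by rewrite (inj_eq enum_val_inj).
  move: q'j qj; rewrite /c /pair_at; case: (enum_val q) => a b; case: (enum_val q') => a' b'.
  rewrite !inE /= xpair_eqE -!(inj_eq val_inj) /= => *.
  by case: ifP; split; lia.
(* Extended by zero to all chosen rows, [u] becomes a relation among the rows of an invertible
   matrix. *)
have sub0 : u *m rowsub (enum_val : 'I_#|P| -> 'I_r) 1%:M *m mxsub s f (simplex_boundary k n) = 0.
  rewrite -mulmxA -rowsubE -mxsub_comp.
  have <- : u *m colsub f B = 0 by rewrite mulmx_colsub -/y y0; apply/matrixP => ? ?; rewrite !mxE.
  by congr (_ *m _); rewrite -mxsub_comp.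
have {sub0} /eqP := sub0; rewrite mulmx_free_eq0 ?row_free_unit // => /eqP u0.
apply/rowP => z; move/rowP/(_ (enum_val z)): u0; rewrite [LHS]mxE [RHS]mxE (bigD1 z) //=.
rewrite big1 => [|z' z'z].
  by rewrite !mxE eqxx mulr1 addr0.
by rewrite !mxE (inj_eq enum_val_inj) (negPf z'z) mulr0.
Qed.

(* The cone from [i] over the tree is acyclic: a cochain that vanishes on the
   edges of [E] and whose coboundary vanishes on the triples through [i] is the
   coboundary of a function constant along [E]. *)
Lemma cone_minor (E : rel 'I_n) i :
    ssrbool.symmetric E -> (forall j, connect E i j) -> injective f ->
    (forall j, ~~ E (enum_val (f j)).1 (enum_val (f j)).2) ->
  exists s, [/\ injective s, forall t, triple_at (enum_val (s t)) i
    & \det (mxsub s f (simplex_boundary k n)) != 0].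
Proof.
move=> symE conE injf fE.
(* Rows of triangles avoiding [i] are set to zero, so an invertible choice of rows can only use
   triangles through [i]. *)
pose A := \matrix_(t, j) (if triple_at (enum_val t) i then simplex_boundary k n t (f j) else 0).
have A_full : row_full A.
  rewrite /row_full -mxrank_tr; apply: inj_row_free => u uA.
  (* [v] extends [u] by zero to a cochain on all pairs. *)
  pose v := colsub f 1%:M *m u^T.
  have v_f j : v (f j) 0 = u 0 j.
    rewrite mxE (bigD1 j) //= !mxE eqxx mul1r big1 ?addr0 // => j' j'j.
    by rewrite !mxE (inj_eq injf) eq_sym (negPf j'j) mul0r.
  have v_E q : E (enum_val q).1 (enum_val q).2 -> v q 0 = 0.
    move=> qE; rewrite mxE big1 // => j _; rewrite !mxE; case: eqVneq => [qj|_].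
      by have := fE j; rewrite -qj qE.
    by rewrite mul0r.
  have dv t : triple_at (enum_val t) i -> (simplex_boundary k n *m v) t 0 = 0.
    move=> ti; rewrite mulmxA mulmx_colsub mulmx1.
    move/rowP/(_ t): uA; rewrite [RHS]mxE => <-; rewrite !mxE; apply: eq_bigr => j _.
    by rewrite !mxE ti mulrC.
  pose F := cochain_at v.
  have F_cycle (a b c : 'I_n) : (a < b)%N -> (b < c)%N -> triple_at (a, b, c) i ->
      F (a, b) - F (a, c) + F (b, c) = 0.
    move=> ab bc ti; have tP : (a, b, c) \in triples n by rewrite inE /= ab bc.
    have et := enum_rankK_in tP tP; rewrite -(simplex_boundary_mul v et).
    by apply: dv; rewrite et.
  have F_ge (a b : 'I_n) : (b <= a)%N -> F (a, b) = 0.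
    move=> ba; rewrite /F /cochain_at big1 // => q _.
    case: eqP => [eq|]; last by rewrite mul0r.
    by have := enum_valP q; rewrite -eq inE /= ltnNge ba.
  (* As [F] vanishes off increasing pairs, at most one term survives: [h c] is the signed value of
     the cochain on the segment from [i] to [c]. *)
  pose h c := F (i, c) - F (c, i).
  have F_h (b c : 'I_n) : (b < c)%N -> F (b, c) = h c - h b.
    move=> bc; rewrite /h; case: (ltngtP b i) => [bi|ib|/val_inj eb].
    - rewrite (F_ge i b) ?(ltnW bi) //; case: (ltngtP c i) => [ci|ic|/val_inj ec].
      + rewrite (F_ge i c) ?(ltnW ci) //.
        have := F_cycle b c i bc ci; rewrite /triple_at eqxx !orbT => /(_ isT) H.
        by apply/eqP; rewrite -subr_eq0 -[X in _ == X]H; apply/eqP; ring.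
      + rewrite (F_ge c i) ?(ltnW ic) //.
        have := F_cycle b i c bi ic; rewrite /triple_at eqxx !orbT => /(_ isT) H.
        by apply/eqP; rewrite -subr_eq0 -oppr_eq0 -[X in _ == X]H; apply/eqP; ring.
      + by rewrite ec (F_ge i i) // subrr sub0r sub0r opprK.
    - have ic := ltn_trans ib bc; rewrite (F_ge b i) ?(ltnW ib) // (F_ge c i) ?(ltnW ic) //.
      have := F_cycle i b c ib bc; rewrite /triple_at eqxx => /(_ isT) H.
      by apply/eqP; rewrite -subr_eq0 -[X in _ == X]H; apply/eqP; ring.
    - by rewrite eb (F_ge i i) // (F_ge c i) -?eb ?(ltnW bc) // subrr !subr0.
  have h_E b c : E b c -> h b = h c.
    have F_E (x y : 'I_n) : (x < y)%N -> E x y -> F (x, y) = 0.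
      move=> xy Exy; have xyP : (x, y) \in pairs n by rewrite inE.
      by rewrite /F -(enum_rankK_in xyP xyP) cochain_at_enum v_E // enum_rankK_in.
    move=> Ebc; case: (ltngtP b c) => [bc|cb|/val_inj-> //].
      by apply/esym/eqP; rewrite -subr_eq0 -F_h // F_E.
    by apply/eqP; rewrite -subr_eq0 -F_h // F_E // symE.
  (* [h] vanishes at [i] and is constant along edges, so connectedness makes it zero everywhere. *)
  have h0 c : h c = 0.
    have /connectP[p] := conE c.
    have : h i = 0 by rewrite /h subrr.
    elim: p (i) => [|x p IHp] y /= hy; first by move=> _ ->.
    by case/andP=> /h_E yx; apply: IHp; rewrite -yx.
  apply/rowP => j; rewrite [RHS]mxE -v_f -cochain_at_enum -/F.
  have := enum_valP (f j); case: (enum_val (f j)) => a b; rewrite inE /= => ab.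
  by rewrite F_h // !h0 subrr.
have s_unit := fullrowsub_unit A_full; set s := fullrankfun A_full in s_unit.
have s_at t : triple_at (enum_val (s t)) i.
  apply: contraT => /negPf nt; have := row_mxsub s id A t.
  rewrite rowE => e0; have: delta_mx 0 t *m rowsub s A == 0 :> 'rV[k]_r.
    by rewrite e0; apply/eqP/rowP => j; rewrite !mxE nt.
  rewrite mulmx_free_eq0 ?row_free_unit // => /eqP/rowP/(_ t).
  by rewrite !mxE !eqxx => /eqP; rewrite oner_eq0.
exists s; split=> //; first exact: fullrankfun_inj.
rewrite -unitfE -unitmxE; congr (_ \in unitmx): s_unit.
by apply/matrixP => t j; rewrite !mxE s_at.
Qed.
End SimplexBoundaryRank.

(** * The quotient by the edges of a graph *)

Section GraphMinors.
Variables (k : fieldType) (n : nat) (E : rel 'I_n).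
Hypothesis simpleE : simple_graph E.
Notation K := (graph_subspace k E).
Notation S := {mpoly k[n]}.

Definition edge_at (q : 'I_#|pairs n|) : bool := E (enum_val q).1 (enum_val q).2.

Lemma delta_sub_graph_subspace q : edge_at q -> (delta_mx (0 : 'I_1) q <= K)%MS.
Proof.
move=> qE; apply: (sumsmx_sup (enum_val q)) => //.
rewrite genmxE; set w := wedge2 _ _; suff -> : delta_mx 0 q = w by [].
apply/rowP => q'; have := enum_valP q; rewrite inE => lt_q.
rewrite /w wedge2_delta // -surjective_pairing (inj_eq enum_val_inj) mxE eqxx.
by rewrite eq_sym.
Qed.

(** Up to sign, each generator is the basis vector of an increasing edge, so at most one dimension
    arises per edge. *)
Lemma rank_graph_subspace : (\rank K <= #|[pred q | edge_at q]|)%N.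
Proof.
case: simpleE => symE irrE.
pose D := rowsub (fun z : 'I_#|[pred q | edge_at q]| => enum_val z) (1%:M : 'M[k]_#|pairs n|).
suff KD : (K <= D)%MS by apply: leq_trans (mxrankS KD) (rank_leq_row _).
have lt_sub (a b : 'I_n) : (a < b)%N -> E a b ->
    (wedge2 (delta_mx 0 a : 'rV[k]_n) (delta_mx 0 b) <= D)%MS.
  move=> ab Eab; have abP : (a, b) \in pairs n by rewrite inE.
  have eq := enum_rankK_in abP abP; set q := enum_rank_in abP (a, b) in eq.
  have qE : q \in [pred q | edge_at q] by rewrite inE /edge_at eq.
  apply: (eq_row_sub (enum_rank_in qE q)); rewrite row_rowsub enum_rankK_in //.
  by apply/rowP => q'; rewrite wedge2_delta // !mxE -eq (inj_eq enum_val_inj).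
apply/sumsmx_subP => -[a b] /= Eab; rewrite genmxE.
case: (ltngtP a b) => [ab|ba|/val_inj ab]; last by rewrite ab irrE in Eab.
  exact: lt_sub.
have -> : wedge2 (delta_mx 0 a : 'rV[k]_n) (delta_mx 0 b) = - wedge2 (delta_mx 0 b) (delta_mx 0 a).
  apply/rowP => q; rewrite !mxE; case: (enum_val q) => i j.
  by rewrite opprB; congr (_ - _); rewrite mulrC.
by rewrite eqmx_opp; apply: lt_sub; rewrite // symE.
Qed.

(** The projection kills the edges, so its invertible row block involves nonedges only, and a rank
    count shows that it uses all of them. Hence, up to an invertible constant matrix, the projection
    merely selects the nonedge columns. *)
Lemma proj_mod_basis :
  exists f : 'I_(\rank (cokermx K)) -> 'I_#|pairs n|,
    [/\ injective f, forall q, (q \in codom f) = ~~ edge_at q,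
        rowsub f (proj_mod K) \in unitmx
      & proj_mod K = colsub f 1%:M *m rowsub f (proj_mod K)].
Proof.
have KC : K *m proj_mod K = 0.
  apply/eqP; rewrite -(mulmx_free_eq0 _ (row_base_free (cokermx K))).
  by rewrite -mulmxA mulmx_base mulmx_coker.
have rowC0 q : edge_at q -> row q (proj_mod K) = 0.
  by move/delta_sub_graph_subspace/submxP => [D eD]; rewrite rowE eD -mulmxA KC mulmx0.
have f_unit := fullrowsub_unit (col_base_full (cokermx K)).
have f_inj := @fullrankfun_inj _ _ _ _ (col_base_full (cokermx K)).
move: (fullrankfun _) f_unit f_inj => f f_unit f_inj.
have fE j : ~~ edge_at (f j).
  apply/negP => /rowC0; rewrite -row_rowsub rowE => /eqP.
  rewrite mulmx_free_eq0 ?row_free_unit // => /eqP/rowP/(_ j).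
  by rewrite !mxE !eqxx => /eqP; rewrite oner_eq0.
have codomE : codom f =i [pred q | ~~ edge_at q].
  have sub : codom f \subset [pred q | ~~ edge_at q].
    by apply/fintype.subsetP => _ /codomP[j ->]; rewrite inE fE.
  apply/(subset_cardP _ sub)/eqP; rewrite eqn_leq subset_leq_card //=.
  rewrite card_codom // card_ord mxrank_coker.
  have := rank_graph_subspace; have := cardC [pred q | edge_at q]; rewrite card_ord.
  have -> : #|[predC [pred q | edge_at q]]| = #|[pred q | ~~ edge_at q]| by apply: eq_card.
  have arith (a b c d : nat) : (a + b = c -> d <= a -> b <= c - d)%N by lia.
  exact: arith.
exists f; split=> //.
have colE q j : colsub f (1%:M : 'M[k]_#|pairs n|) q j = (q == f j)%:R by rewrite !mxE.
have rowE j l : rowsub f (proj_mod K) j l = proj_mod K (f j) l by rewrite mxE.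
apply/matrixP => q l; rewrite [RHS]mxE; have [/codomP[j ->]|qf] := boolP (q \in codom f).
  rewrite (bigD1 j) //= colE rowE eqxx mul1r big1 ?addr0 // => j' j'j.
  by rewrite colE (inj_eq f_inj) eq_sym (negPf j'j) mul0r.
rewrite big1 => [|j _].
  have qE : edge_at q by have := codomE q; rewrite (negPf qf) inE => /esym/negbFE.
  by have /rowP/(_ l) := rowC0 q qE; rewrite [LHS]mxE [RHS]mxE.
rewrite colE; case: eqVneq => [qj|_]; last by rewrite mul0r.
by rewrite qj codom_f in qf.
Qed.

End GraphMinors.

(** * Minors for a tree *)

Section TreeMinors.
Variables (k : fieldType) (n : nat) (E : rel 'I_n).
Hypotheses (n_gt1 : (1 < n)%N) (treeE : is_tree E).
Notation S := {mpoly k[n]}.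

Lemma tree_simple : simple_graph E. Proof. by case: treeE. Qed.

Lemma tree_degree_gt0 i : (0 < degree E i)%N.
Proof.
have [_ conE _] := treeE.
have [j ji] : exists j : 'I_n, j != i.
  have lt1 : (1 < n)%N by []. have lt0 : (0 < n)%N by lia.
  have [i0|i0] := eqVneq (val i) 0%N.
    by exists (Ordinal lt1); rewrite -val_eqE /= i0.
  by exists (Ordinal lt0); rewrite -val_eqE /= eq_sym.
have /connectP[[|x p] /= + ej] := conE i j; first by rewrite ej eqxx in ji.
by case/andP=> Eix _; apply/card_gt0P; exists x.
Qed.

Lemma tree_degree_sum : (\sum_i degree E i = (n - 1) * 2)%N.
Proof.
have [[symE irrE] _ nE] := treeE.
rewrite -(card_pairs2 symE irrE) subn1 -nE; congr (_ * _)%N; apply: eq_card => p.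
by rewrite !inE.
Qed.

(** Adjacency in the complement graph; excluding the diagonal keeps it simple, so the counting
    lemmas apply. *)
Definition nonadjacent (a b : 'I_n) : bool := (a != b) && ~~ E a b.

Lemma nonadjacent_sym : ssrbool.symmetric nonadjacent.
Proof. by case: tree_simple => symE _ a b; rewrite /nonadjacent eq_sym symE. Qed.

Lemma nonadjacent_irr : irreflexive nonadjacent.
Proof. by move=> a; rewrite /nonadjacent eqxx. Qed.

Lemma card_nonadjacent i : (#|nonadjacent i| + degree E i = n - 1)%N.
Proof.
have [_ irrE] := tree_simple.
have := cardC1 i; rewrite card_ord subn1 => <-.
rewrite -(cardID (E i) (predC1 i)) addnC; congr (_ + _)%N; apply: eq_card => j; rewrite !inE.
  rewrite !unfold_in /=; case: (boolP (E i j)) => [Eij|_]; rewrite ?andbF ?andbT //.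
  by apply/esym; apply: contraTneq Eij => ->; rewrite irrE.
by rewrite unfold_in /nonadjacent eq_sym andbC.
Qed.

Variables (r : nat) (f : 'I_r -> 'I_#|pairs n|).
Hypotheses (f_inj : injective f) (fE : forall q, (q \in codom f) = ~~ edge_at E q).
Implicit Type s : 'I_r -> 'I_#|triples n|.

Lemma sum_nonedges (G : 'I_n * 'I_n -> nat) :
  (\sum_j G (enum_val (f j)) = \sum_(p in pairs n | nonadjacent p.1 p.2) G p)%N.
Proof.
transitivity (\sum_(q | ~~ edge_at E q) G (enum_val q))%N.
  have := big_image addn 0%N f predT (fun q => G (enum_val q)) => /= <-.
  rewrite big_uniq /=; last by rewrite map_inj_uniq ?enum_uniq.
  by apply: eq_bigl => q; rewrite -fE.
rewrite -[LHS](big_enum_val_cond (fun p => ~~ E p.1 p.2) G).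
apply: eq_bigl => p; rewrite inE /nonadjacent; case: ltnP => //= lt_p.
by rewrite -val_eqE /= ltn_eqF.
Qed.

(** The column exponent at [i] counts nonedges through [i], which is the degree of [i] in the
    complement graph. *)
Lemma nonedge_exponent i :
  ((\sum_j pair_mon (enum_val (f j)))%MM i + degree E i = n - 1)%N.
Proof.
rewrite -(card_nonadjacent i) -(sum_pair_at i nonadjacent_sym nonadjacent_irr).
rewrite -(sum_nonedges (fun p => pair_at p i)) mnm_sumE; congr (_ + _)%N.
by apply: eq_bigr => j _; rewrite pair_monE ?enum_valP.
Qed.

(** The handshake lemma in the complement graph, whose degrees add up to n(n-1) - 2(n-1). *)
Lemma card_nonedges : (r * 2 = (n - 1) * (n - 2))%N.
Proof.
have : (r * 2 + \sum_i degree E i = n * (n - 1))%N.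
  have -> : r = #|[pred p in pairs n | nonadjacent p.1 p.2]|.
    by have := sum_nonedges (fun=> 1%N); rewrite sum1_card card_ord sum1_card.
  rewrite (card_pairs2 nonadjacent_sym nonadjacent_irr) -big_split /=.
  by under eq_bigr do rewrite card_nonadjacent; rewrite sum_nat_const card_ord.
by rewrite tree_degree_sum; nia.
Qed.

Lemma row_exponent s i :
  (\sum_j triple_mon (enum_val (s j)))%MM i = #|[pred j | triple_at (enum_val (s j)) i]|.
Proof.
rewrite mnm_sumE -sum1_card [RHS]big_mkcond /=; apply: eq_bigr => j _.
by rewrite triple_monE ?enum_valP // inE; case: ifP.
Qed.

(** These pairs are the edges of the complete graph on the other n-2 vertices. *)
Lemma card_pairs_avoiding i j : i != j ->
  (#|[pred q : 'I_#|pairs n| | ~~ pair_at (enum_val q) i && ~~ pair_at (enum_val q) j]| * 2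
    <= (n - 2) * (n - 3))%N.
Proof.
move=> ij; pose M (a b : 'I_n) := [&& a != b, a \notin [set i; j]%SET & b \notin [set i; j]%SET].
have symM : ssrbool.symmetric M by move=> a b; rewrite /M eq_sym andbA andbAC -andbA.
have irrM : irreflexive M by move=> a; rewrite /M eqxx.
rewrite (card_enum_val _ (fun p => ~~ pair_at p i && ~~ pair_at p j)).
rewrite (eq_card (B := [pred p in pairs n | M p.1 p.2])) => [|[a b]]; last first.
  rewrite !inE /M /pair_at /= !inE; case: ltnP => //= lt_p.
  rewrite -[a == b]val_eqE /= ltn_eqF //= ![_ == a]eq_sym ![_ == b]eq_sym.
  by rewrite !negb_or; do !case: (_ == _).
have ij2 : #|[set i; j]%SET| = 2%N by rewrite cards2 ij.
rewrite card_pairs2 // (bigID (mem [set i; j]%SET)) /= big1 => [|a aij]; last first.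
  by apply: eq_card0 => b; rewrite unfold_in /M aij andbF.
rewrite add0n (_ : n - 2 = #|[predC [set i; j]%SET]|)%N; last first.
  by have := cardC [set i; j]%SET; rewrite ij2 card_ord; lia.
rewrite -sum_nat_const; apply: leq_sum => a aij.
have := cardC (a |: [set i; j])%SET; rewrite cardsU1 aij ij2 card_ord => c3.
rewrite -[X in (_ <= X - _)%N]c3 -[X in (_ <= X)%N](_ : #|[predC (a |: [set i; j])%SET]| = _); last by lia.
by apply/subset_leq_card/fintype.subsetP => b; rewrite !inE /M eq_sym unfold_in !inE => /and3P[/negPf-> _ /negPf->].
Qed.

Lemma minor_exponent_ge s i : \det (mxsub s f (simplex_boundary k n)) != 0 ->
  ((\sum_j pair_mon (enum_val (f j)))%MM i + (degree E i - 1)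
    <= (\sum_j triple_mon (enum_val (s j)))%MM i)%N.
Proof.
move=> det_neq0; have [j ij] : exists j, i != j.
  have /card_gt0P[j] := tree_degree_gt0 i; rewrite unfold_in => Eij; exists j.
  by apply: contraTneq Eij => <-; case: tree_simple => _ ->.
(* [x] and [y] count the chosen triangles through and avoiding [i], [g] is the column exponent and
   [d] the degree. The bound rests on C(n-1, 2) - C(n-2, 2) = n-2. *)
have arith (x y q g d : nat) : (x + y = r -> y <= q -> q * 2 <= (n - 2) * (n - 3) ->
    g + d = n - 1 -> 0 < d -> g + (d - 1) <= x)%N.
  move: card_nonedges n_gt1; case: (n) => [|[|[|m]]] //; rewrite !subSS !subn0; nia.
apply: arith (card_rows_avoiding i j det_neq0) (card_pairs_avoiding ij)
  (nonedge_exponent i) (tree_degree_gt0 i).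
rewrite row_exponent; have := cardC [pred t | triple_at (enum_val (s t)) i].
by rewrite card_ord => card_r; apply: etrans card_r; congr (_ + _)%N; apply: eq_card.
Qed.

(** For [j] other than [i], a chosen triangle through [j] also contains [i], leaving at most n-2 of
    them; at [i] the total number [r] of rows is a sufficient bound. *)
Lemma cone_minor_exponent i : exists2 s,
    injective s /\ \det (mxsub s f (simplex_boundary k n)) != 0 &
    forall j, ((\sum_j triple_mon (enum_val (s j)))%MM j <=
       (\sum_j pair_mon (enum_val (f j)))%MM j + (degree E j - 1) + (j == i) * r)%N.
Proof.
have [[symE _] conE _] := treeE.
have [j|s [s_inj s_i det_neq0]] := cone_minor k symE (conE i) f_inj.
  by have := fE (f j); rewrite codom_f => /esym.
exists s => // j; rewrite row_exponent; case: eqVneq => [_|ji].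
  by rewrite mul1n (leq_trans (max_card _)) ?card_ord ?leq_addl.
have := nonedge_exponent j; have := tree_degree_gt0 j.
suff: (#|[pred t | triple_at (enum_val (s t)) j]| <= n - 2)%N by lia.
rewrite eq_sym in ji; apply: leq_trans (card_triple_at2 ji).
have h_inj : injective (fun t => enum_val (s t)) by move=> t t' /enum_val_inj/s_inj.
rewrite -(card_image h_inj); apply/subset_leq_card/fintype.subsetP => _ /fintype.imageP[t tj ->].
by rewrite inE s_i enum_valP.
Qed.

End TreeMinors.

(** * The Fitting ideal of a tree and its primary decomposition *)

(** Each maximal minor is a scalar times a monomial. Nonzero scalars are invertible, so the
    monomials of the nonzero minors generate the same ideal. *)
Lemma Fitt0_tree (k : fieldType) (n : nat) (E : rel 'I_n) :
    (1 < n)%N -> is_tree E ->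
  exists2 A : set 'X_{1..n},
    Fitt0 (koszul_module_mx (graph_subspace k E))
      = ideal_gen [set h | exists2 m, A m & h = 'X_[m]] &
    (forall m i, A m -> (degree E i - 1 <= m i)%N) /\
    exists B, forall i, exists2 m, A m &
      forall j, (m j <= degree E j - 1 + (j == i) * B)%N.
Proof.
move=> n_gt1 treeE.
have [f [f_inj fE C_unit C_eq]] := proj_mod_basis k (tree_simple treeE).
set r := \rank _ in f f_inj fE C_unit C_eq.
set C := proj_mod _ in C_unit C_eq.
pose col_mon := (\sum_j pair_mon (enum_val (f j)))%MM.
pose row_mon (s : 'I_r -> 'I_#|triples n|) := (\sum_j triple_mon (enum_val (s j)))%MM.
pose minor s := \det (mxsub s f (simplex_boundary k n)).
have exp_ge s i : minor s != 0 -> (col_mon i + (degree E i - 1) <= row_mon s i)%N.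
  exact: minor_exponent_ge.
have col_row s : minor s != 0 -> (col_mon <= row_mon s)%MM.
  by move=> s0; apply/mnm_lepP => i; apply: leq_trans (exp_ge s i s0); apply: leq_addr.
(* The truncated difference of exponents is exact here by [col_row], because the minor is
   nonzero. *)
exists [set m | exists s, [/\ injective s, minor s != 0 & m = (row_mon s - col_mon)%MM]]; last first.
  split=> [_ i [s [_ s0 ->]]|].
    by have := exp_ge s i s0; rewrite mnmBE; lia.
  exists r => i; have [s [s_inj s0] s_le] := cone_minor_exponent k n_gt1 treeE f_inj fE i.
  exists (row_mon s - col_mon)%MM; first by exists s.
  by move=> j; have := s_le j; rewrite mnmBE -/col_mon -/(row_mon s); lia.
(* [c] is the determinant of the change of basis of the quotient, a nonzero constant common to all
   minors. *)
pose c := \det (rowsub f C).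
have c0 : c != 0 by rewrite -unitfE -unitmxE.
have detE s : \det (rowsub s (koszul_module_mx (graph_subspace k E)))
    = (minor s * c)%:MP * 'X_[row_mon s - col_mon].
  rewrite /koszul_module_mx -/C C_eq map_mxM /= mulmxA.
  have -> : koszul_delta3 k n *m map_mx (@mpolyC n k) (colsub f 1%:M) = colsub f (koszul_delta3 k n).
    by rewrite map_mxsub map_mx1 mulmx_colsub mulmx1.
  rewrite -mul_rowsub_mx -mxsubrc det_mulmx det_map_mx -/c mpolyCM mulrAC; congr (_ * _).
  have := minor_scaling k f s; rewrite -/col_mon -/(row_mon s) -/(minor s) => eqm.
  have X0 : 'X_[col_mon] != 0 :> {mpoly k[n]} by rewrite -msupp_eq0 msuppX.
  apply: (mulIf X0); rewrite eqm; have [->|s0] := eqVneq (minor s) 0.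
    by rewrite mpolyC0 mulr0 !mul0r.
  by rewrite -mulrA -mpolyXD submK ?col_row // mulrC.
apply/seteqP; split; apply: ideal_gen_min (ideal_gen_is_ideal _) _.
  move=> _ [s s_inj ->]; rewrite detE.
  set I := ideal_gen _; have [I0 _ IM] : is_ideal I by apply: ideal_gen_is_ideal.
  have [s0|s0] := eqVneq (minor s) 0; first by rewrite s0 mul0r mpolyC0 mul0r.
  by apply: IM; apply: sub_ideal_gen; exists (row_mon s - col_mon)%MM => //; exists s.
move=> _ [_ [s [s_inj s0 ->]] ->].
set I := ideal_gen _; have [_ _ IM] : is_ideal I by apply: ideal_gen_is_ideal.
have -> : 'X_[row_mon s - col_mon] = ((minor s * c)^-1)%:MP
    * \det (rowsub s (koszul_module_mx (graph_subspace k E))).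
  by rewrite detE mulrA -mpolyCM mulVf ?mulf_neq0 // mpolyC1 mul1r.
by apply: IM; apply: sub_ideal_gen; exists s.
Qed.

Theorem mainTheorem2 (k : closedFieldType) (char0 : [pchar k] =i pred0)
    (n : nat) (n_ge4 : (4 <= n)%N) (T : rel 'I_n) (treeT : is_tree T) :
  let D := [set i : 'I_n | (2 <= degree T i)%N] in
  let Q (i : 'I_n) : set {mpoly k[n]} :=
    ideal_exp (@var_ideal k n i) (degree T i - 1) in
  exists J : set {mpoly k[n]},
    [/\ monomial_ideal J, radical J <> J, radical J = @irrelevant_ideal k n,
        (forall i : 'I_n, D i -> primary_ideal (Q i)) /\ primary_ideal J &
        Fitt0 (koszul_module_mx (graph_subspace k T))
          = (\bigcap_(i in D) Q i) `&` J].
Proof.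
move=> D Q; have n_gt1 : (1 < n)%N by lia.
have [A -> [A_ge [B A_le]]] := Fitt0_tree k n_gt1 treeT.
have [|J [monJ nradJ radJ primJ ->]] := monomial_decomposition k A_ge A_le.
  (* The degrees sum to 2(n-1); removing one per vertex leaves n-2, which is at least 2. *)
  have : (\sum_i degree T i <= \sum_i (degree T i - 1 + 1))%N by apply: leq_sum => i _; lia.
  by rewrite tree_degree_sum // big_split /= sum_nat_const card_ord; lia.
(* Leaves have exponent 0, so the positive exponents single out exactly [D]. *)
have -> : [set i | (0 < degree T i - 1)%N] = D.
  by apply/seteqP; split=> i; rewrite /D /= subn_gt0.
exists J; split=> //; split=> // i Di.
by apply: var_ideal_exp_primary; rewrite subn_gt0.
Qed.
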